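(* Let $(X,d)$ be a metric space, $t_0\in X$, let $\mathcal{L}$ be the set of all $1$-Lipschitz functions $f:X\to\mathbb{R}$ with $f(t_0)=0$, and define $U:X\to\ell_\infty(\mathcal{L})$ by $U(t)=(f(t))_{f\in\mathcal{L}}$. Then: (1) $U$ is an isometry (i.e. $\|U(x)-U(y)\|=d(x,y)$ for all $x,y\in X$). (2) For any $1$-Lipschitz function $g:X\to\mathbb{R}$ there exists a $1$-Lipschitz affine functional $\tilde g:\ell_\infty(\mathcal{L})\to\mathbb{R}$ such that $g=\tilde g\circ U$. (3) For any $\lambda$-injective Banach space $Z$ and any $1$-Lipschitz function $g:X\to Z$, there exists a $\lambda$-Lipschitz affine map $\tilde g:\ell_\infty(\mathcal{L})\to Z$ such that $g=\tilde g\circ U$.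
   Context: Banach spaces are real; $\ell_\infty(\Gamma)$ is the space of bounded real functions on the set $\Gamma$ with the supremum norm. A Banach space $Z$ is $\lambda$-injective if, whenever $Z$ is isometrically (linearly) embedded in a Banach space $W$, there is a linear projection from $W$ onto $Z$ of norm at most $\lambda$. An affine map is a linear map plus a constant. *)

(* Defs.v *)
From HB Require Import structures.
From mathcomp Require Import all_boot all_order all_algebra.
From mathcomp Require Import all_classical all_reals all_analysis.

Set Implicit Arguments.
Unset Strict Implicit.
Unset Printing Implicit Defensive.

Import Order.TTheory GRing.Theory Num.Theory.
Import numFieldNormedType.Exports.

Local Open Scope classical_set_scope.
Local Open Scope ring_scope.

Section ell_infty.
Context (R : realType) (T : Type).

Definition bounded_pred : {pred (T -> R)} := mem (bounded_fun : set (T -> R)).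

Record ell_infty : Type := EllInfty {
  ell_infty_fun :> T -> R ;
  _ : ell_infty_fun \in bounded_pred }.

HB.instance Definition _ := [isSub for ell_infty_fun].
HB.instance Definition _ := [Choice of ell_infty by <:].

Lemma bounded_predP (f : T -> R) :
  reflect (exists M, forall t, `|f t| <= M) (f \in bounded_pred).
Proof.
apply: (iffP idP) => [/set_mem[M [_ fM]]|[M fM]].
  by exists (M + 1) => t; apply: fM => //; rewrite ltrDl.
apply/mem_set; exists M; split=> [|N MN t _]; first exact: num_real.
exact: le_trans (fM t) (ltW MN).
Qed.

Lemma bounded_pred_submod_closed : submod_closed bounded_pred.
Proof.
split=> [|a f g /bounded_predP[M fM] /bounded_predP[N gN]]; apply/bounded_predP.
  by exists 0 => t; rewrite normr0.
exists (`|a| * M + N) => t; apply: le_trans (ler_normD _ _) _.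
by rewrite lerD//= normrM ler_wpM2l.
Qed.

HB.instance Definition _ :=
  GRing.isSubmodClosed.Build _ _ bounded_pred bounded_pred_submod_closed.
HB.instance Definition _ := [SubChoice_isSubLmodule of ell_infty by <:].

(* On the empty index set the range is empty and its sup is 0, as expected. *)
Definition sup_norm (f : ell_infty) : R := sup (range (fun t => `|f t|)).

Lemma ell_infty_ubound (f : ell_infty) : has_ubound (range (fun t => `|f t|)).
Proof.
by have /bounded_predP[M fM] := valP f; exists M => _ [t _ <-]; exact: fM.
Qed.

Lemma sup_norm_ub (f : ell_infty) t : `|f t| <= sup_norm f.
Proof. by apply: ub_le_sup; [exact: ell_infty_ubound|exists t]. Qed.

Lemma sup_norm_le (f : ell_infty) (M : R) :
  0 <= M -> (forall t, `|f t| <= M) -> sup_norm f <= M.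
Proof.
move=> M0 fM; rewrite /sup_norm.
have [->|/set0P r0] := eqVneq (range (fun t => `|f t|)) set0.
  by rewrite sup0.
by apply: ge_sup => // _ [t _ <-].
Qed.

Lemma sup_norm_ge0 (f : ell_infty) : 0 <= sup_norm f.
Proof.
rewrite /sup_norm.
have [->|/set0P[_ [t _ _]]] := eqVneq (range (fun t => `|f t|)) set0.
  by rewrite sup0.
exact: le_trans (normr_ge0 _) (sup_norm_ub f t).
Qed.

Lemma ler_sup_normD (f g : ell_infty) :
  sup_norm (f + g) <= sup_norm f + sup_norm g.
Proof.
apply: sup_norm_le => [|t]; first by rewrite addr_ge0 ?sup_norm_ge0.
by apply: le_trans (ler_normD _ _) _; rewrite lerD ?sup_norm_ub.
Qed.

Lemma ler_sup_normZ (a : R) (f : ell_infty) :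
  sup_norm (a *: f) <= `|a| * sup_norm f.
Proof.
apply: sup_norm_le => [|t]; first by rewrite mulr_ge0 ?sup_norm_ge0.
by rewrite [X in `|X|](_ : _ = a * f t)// normrM ler_wpM2l ?sup_norm_ub.
Qed.

Lemma sup_normZ (a : R) (f : ell_infty) : sup_norm (a *: f) = `|a| * sup_norm f.
Proof.
apply/eqP; rewrite eq_le ler_sup_normZ/=.
have [->|a0] := eqVneq a 0; first by rewrite normr0 mul0r sup_norm_ge0.
rewrite -ler_pdivlMl ?normr_gt0// -normfV.
by rewrite -[X in sup_norm X <= _](scalerK a0) ler_sup_normZ.
Qed.

Lemma sup_norm0_eq0 (f : ell_infty) : sup_norm f = 0 -> f = 0.
Proof.
move=> f0; apply/val_inj/funext => t; apply/eqP.
by rewrite -normr_le0 -f0; exact: sup_norm_ub.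
Qed.

HB.instance Definition _ :=
  Lmodule_isNormed.Build R ell_infty ler_sup_normD sup_normZ sup_norm0_eq0.

Lemma ell_infty_normE (f : ell_infty) : `|f| = sup (range (fun t => `|f t|)).
Proof. by []. Qed.

Lemma ell_infty_complete (F : set_system ell_infty) :
  ProperFilter F -> cauchy F -> cvg F.
Proof.
move=> FF /cauchy_ballP F_cauchy.
have ev_le t (f g : ell_infty) : `|f t - g t| <= `|f - g|.
  exact: (sup_norm_ub (f - g) t).
have cvgt t : cvg ((fun f : ell_infty => f t) @ F).
  apply: cauchy_cvg; apply/cauchy_ballP => e e0.
  have := F_cauchy e e0; rewrite !near_simpl/= => -[[A B]/= [FA FB] AB].
  exists ((fun f : ell_infty => f t) @` A, (fun f : ell_infty => f t) @` B).
    by split; [apply: filterS FA|apply: filterS FB] => f ?; exists f.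
  move=> [_ _]/= [[f Af <-] [g Bg <-]]; apply: le_lt_trans (ev_le _ _ _) _.
  by have := AB (f, g) (conj Af Bg); rewrite -ball_normE.
pose l t : R := lim ((fun f : ell_infty => f t) @ F).
have close (e : R) : 0 < e -> F [set f | forall t, `|l t - f t| <= e].
  move=> e0; have := F_cauchy e e0.
  rewrite !near_simpl/= => -[[A B]/= [FA FB] AB].
  apply: filterS FB => g Bg t.
  have lg : `|f t - g t| @[f --> F] --> `|l t - g t|.
    by apply: cvg_norm; apply: cvgB; [exact: cvgt|exact: cvg_cst].
  apply: (cvgr_to_le lg).
  apply: filterS FA => f Af; apply: le_trans (ev_le _ _ _) _; apply: ltW.
  by have := AB (f, g) (conj Af Bg); rewrite -ball_normE.
have [g lg] := filter_ex (close 1 ltr01).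
have lb : l \in bounded_pred.
  apply/bounded_predP; exists (1 + `|g|) => t.
  rewrite -[l t](subrK (g t)); apply: le_trans (ler_normD _ _) _.
  by rewrite lerD ?lg ?sup_norm_ub.
apply/cvg_ex; exists (EllInfty lb); apply/cvgrPdist_le => e e0.
apply: filterS (close e e0) => f lf; apply: sup_norm_le; first exact: ltW.
exact: lf.
Qed.

HB.instance Definition _ := Uniform_isComplete.Build ell_infty
  ell_infty_complete.

End ell_infty.

(* The library's k.-lipschitz is only available between normed modules. *)
Definition metric_lipschitz (R : realType) (X : metricType R)
    (Z : normedModType R) (k : R) (g : X -> Z) : Prop :=
  forall x y, `|g x - g y| <= k * mdist x y.

Definition affine (R : realType) (V W : lmodType R) (g : V -> W) : Prop :=
  exists (h : {linear V -> W}) (c : W), forall v, g v = h v + c.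

(* Z is identified with its image under the isometric embedding j, and
   projections onto it are idempotent endomorphisms of W with range j(Z). *)
Definition injective_banach (R : realType) (lambda : R)
    (Z : completeNormedModType R) : Prop :=
  forall (W : completeNormedModType R) (j : {linear Z -> W}),
    (forall z, `|j z| = `|z|) ->
    exists P : {linear W -> W},
      [/\ range P = range j,
          forall w, P (P w) = P w &
          forall w, `|P w| <= lambda * `|w| ].

Section canonical_embedding.
Context (R : realType) (X : metricType R) (t0 : X).

Definition pointed_lipschitz : set (X -> R) :=
  [set f | metric_lipschitz 1 f /\ f t0 = 0].

Lemma eval_bounded (t : X) :
  (fun f : pointed_lipschitz => val f t) \in
  @bounded_pred R pointed_lipschitz.
Proof.
apply/bounded_predP; exists (mdist t t0) => -[f fL] /=.
have /set_mem[lipf ft0] := fL.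
by rewrite -[f t]subr0 -ft0 -[leRHS]mul1r; exact: lipf.
Qed.

Definition canonical_embedding (t : X) : ell_infty R pointed_lipschitz :=
  EllInfty (eval_bounded t).

End canonical_embedding.

(* Main.v *)
(* Evaluation at f is a linear functional of norm at most 1 on
   ell_infty(pointed_lipschitz t0), and evaluating canonical_embedding t0 t at
   f = phi o (g - g t0) gives phi (g t - g t0) for every functional phi in the
   dual unit ball of Z. Letting phi vary yields a linear contraction into
   ell_infty(dual ball), which contains Z isometrically by Hahn-Banach;
   composing with a projection onto Z of norm at most lambda and adding g t0
   gives the extension of g. For Hahn-Banach: a minimal sublinear functional
   is linear, and minimal ones exist below any given one by Zorn's lemma. *)

Require Import Defs.
From HB Require Import structures.
From mathcomp Require Import all_boot all_order all_algebra.
From mathcomp Require Import all_classical all_reals all_analysis.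

Set Implicit Arguments.
Unset Strict Implicit.
Unset Printing Implicit Defensive.

Import Order.TTheory GRing.Theory Num.Theory.
Import numFieldNormedType.Exports.

Local Open Scope classical_set_scope.
Local Open Scope ring_scope.

(** Bundles functions that are only obtained inside a proof, such as minimal functionals or maps
    defined by choice. *)
Lemma linear_exists (R : pzRingType) (V W : lmodType R) (f : V -> W) :
  linear f -> exists h : {linear V -> W}, h =1 f.
Proof.
move=> lf; pose M := GRing.isLinear.Build R V W *:%R f lf.
by exists (HB.pack_for {linear V -> W} f M).
Qed.

(** * Hahn-Banach theorem for sublinear functionals *)

Section sublinear.
Context (R : realType) (V : lmodType R).
Implicit Types (p q : V -> R) (x y : V).

(* For 0 <= a the inequality p (a *: x) <= a * p x is enough: applied to a^-1 it
   gives the usual equality. *)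
Definition sublinear p :=
  (forall x y, p (x + y) <= p x + p y) /\
  (forall a x, 0 <= a -> p (a *: x) <= a * p x).

Lemma sublinear0 p : sublinear p -> p 0 = 0.
Proof.
move=> [pD pZ]; apply/eqP; rewrite eq_le.
have := pZ 0 0 (lexx _); rewrite scaler0 mul0r => -> /=.
by have := pD 0 0; rewrite addr0 -subr_ge0 addrK.
Qed.

Lemma sublinearZ p a x : sublinear p -> 0 <= a -> p (a *: x) = a * p x.
Proof.
move=> sp; rewrite le_eqVlt => /predU1P[<-|a0].
  by rewrite scale0r mul0r sublinear0.
apply/eqP; rewrite eq_le; apply/andP; split; first exact: sp.2 (ltW a0).
rewrite -ler_pdivlMl// -[X in p X <= _](scalerK (lt0r_neq0 a0)).
by apply: sp.2; rewrite invr_ge0 ltW.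
Qed.

Lemma sublinear_geN p x : sublinear p -> - p (- x) <= p x.
Proof.
move=> sp; rewrite -subr_ge0 opprK -[leLHS](sublinear0 sp) -[X in p X](subrr x).
exact: sp.1.
Qed.

(** Subadditivity survives because [f] and [g] vary independently on the right. The minorant [b]
    keeps every [inf] from being a default value. Applied to a tilting family and to chains in
    Zorn's lemma. *)
Lemma sublinear_inf (F : set (V -> R)) (b : V -> R) : F !=set0 ->
  (forall f x, F f -> b x <= f x) ->
  (forall f g x y, F f -> F g -> exists2 h, F h & h (x + y) <= f x + g y) ->
  (forall f a x, 0 <= a -> F f -> exists2 h, F h & h (a *: x) <= a * f x) ->
  sublinear (fun x => inf [set f x | f in F]) /\
  forall f x, F f -> inf [set f x | f in F] <= f x.
Proof.
move=> [f0 Ff0] Fb FD FZ.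
have infle f x : F f -> inf [set f x | f in F] <= f x.
  by move=> Ff; apply: ge_inf; [exists (b x) => _ [h Fh <-]; exact: Fb|exists f].
have leinf x m : (forall f, F f -> m <= f x) -> m <= inf [set f x | f in F].
  by move=> mF; apply: lb_le_inf; [exists (f0 x), f0|move=> _ [h Fh <-]; exact: mF].
split=> //; split=> [x y|a x a0].
  rewrite -lerBlDr; apply: (leinf) => f Ff; rewrite lerBlDr -lerBlDl.
  apply: leinf => g Fg; rewrite lerBlDl.
  by have [h Fh] := FD f g x y Ff Fg; apply: le_trans; exact: infle.
have infZ f : F f -> inf [set f (a *: x) | f in F] <= a * f x.
  by move=> Ff; have [h Fh] := FZ f a x a0 Ff; apply: le_trans; exact: infle.
move: a0; rewrite le_eqVlt => /predU1P[a0|a0].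
  by have := infZ _ Ff0; rewrite -a0 !mul0r.
rewrite -ler_pdivrMl//; apply: leinf => f Ff.
by rewrite ler_pdivrMl//; exact: infZ.
Qed.

(* The witness is x |-> inf_(t >= 0) (p (x + t y) - t p y). *)
Lemma sublinear_tilt p y : sublinear p ->
  exists q, [/\ sublinear q, forall x, q x <= p x & q (- y) <= - p y].
Proof.
move=> sp; have [pD pZ] := sp.
pose h t x := p (x + t *: y) - t * p y.
have [||||sq qle] := @sublinear_inf [set h t | t in [set t | 0 <= t]]
  (fun x => - p (- x)).
- by exists (h 0), 0 => /=.
(* Here [t * p y = p (t *: y) <= p (x + t *: y) + p (- x)]. *)
- move=> _ x [t /= t0 <-]; rewrite /h lerBrDr addrC lerBlDr -sublinearZ//.
  by apply: le_trans (pD _ _); rewrite addrAC subrr add0r.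
- move=> _ _ x z [s /= s0 <-] [t /= t0 <-]; exists (h (s + t)).
    by exists (s + t) => //=; rewrite addr_ge0.
  rewrite /h addrACA -opprD -mulrDl lerB// scalerDl addrACA; exact: pD.
- move=> _ a x a0 [t /= t0 <-]; exists (h (a * t)).
    by exists (a * t) => //=; rewrite mulr_ge0.
  by rewrite /h mulrBr mulrA lerB// -scalerA -scalerDr; exact: pZ.
(* The parameter [t = 0] gives the bound by [p], and [t = 1] the bound at [- y]. *)
eexists; split; first exact: sq.
  move=> x; apply: le_trans (qle (h 0) x _) _; first by exists 0 => /=.
  by rewrite /h scale0r mul0r addr0 subr0.
apply: le_trans (qle (h 1) _ _) _; first by exists 1 => /=.
by rewrite /h scale1r mul1r addNr (sublinear0 sp) sub0r.
Qed.

Lemma sublinear_minimal p : sublinear p -> exists q,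
  [/\ sublinear q, forall x, q x <= p x &
      forall r, sublinear r -> (forall x, r x <= q x) -> forall x, q x <= r x].
Proof.
move=> sp; pose P q := sublinear q /\ forall x, q x <= p x.
pose T := {q | P q}.
(* The order is reversed, so that a maximal element in Zorn's lemma is a minimal functional. *)
pose below (s t : T) := `[< forall x, sval t x <= sval s x >].
have p0 : T by exists p; split.
have [| |A totA|q minq] := @ZL_preorder T p0 below.
- by move=> s; apply/asboolP.
- move=> r s t /asboolP rs /asboolP st; apply/asboolP => x.
  exact: le_trans (st x) (rs x).
- have [->|/set0P[s0 As0]] := eqVneq A set0; first by exists p0.
  pose F := [set sval s | s in A].
  have [||||sq qle] := @sublinear_inf F (fun x => - p (- x)).
  + by exists (sval s0), s0.
  (* Members of the chain lie below [p], so [- p (- x) <= - s (- x) <= s x]. *)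
  + move=> _ x [[s [/= ss sp']] _ <-] /=; apply: le_trans (sublinear_geN _ ss).
    by rewrite lerN2.
  + move=> _ _ x y [s As <-] [t At <-]; have [ss st] := ((svalP s).1, (svalP t).1).
    (* The smaller of the two members serves as [h]. *)
    have [/asboolP st'|/asboolP ts] := totA _ _ As At.
      exists (sval t); first by exists t.
      by apply: le_trans (st.1 _ _) _; rewrite lerD2r.
    exists (sval s); first by exists s.
    by apply: le_trans (ss.1 _ _) _; rewrite lerD2l.
  + move=> _ a x a0 [s As <-]; exists (sval s); first by exists s.
    exact: (svalP s).1.2.
  have qp : forall x, inf [set f x | f in F] <= p x.
    move=> x; apply: le_trans (qle (sval s0) x _) _; first by exists s0.
    exact: (svalP s0).2.
  exists (exist P _ (conj sq qp)) => s As; apply/asboolP => x /=.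
  by apply: qle; exists s.
exists (sval q); split; [exact: (svalP q).1|exact: (svalP q).2|].
move=> r sr rq x.
have rp y : r y <= p y := le_trans (rq y) ((svalP q).2 y).
by have /asboolP := minq (exist P r (conj sr rp)) (asboolT rq).
Qed.

(** Tilting a minimal [q] along [y] cannot lower it, so [q (- y) <= - q y] and [q] is odd. Oddness
    turns subadditivity into additivity and extends homogeneity to negative scalars. *)
Lemma hahn_banach_sublinear p : sublinear p ->
  exists h : {linear V -> R^o}, forall x, h x <= p x.
Proof.
move=> /sublinear_minimal[q [sq qp qmin]].
have qN y : q (- y) = - q y.
  apply/eqP; rewrite eq_le; have [r [sr rq ry]] := sublinear_tilt y sq.
  rewrite (le_trans (qmin r sr rq _) ry) /= lerNl; exact: sublinear_geN.
have [//|h hE] := @linear_exists R V R^o q; last first.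
  by exists h => x; rewrite hE.
have qD x y : q (x + y) = q x + q y.
  apply/eqP; rewrite eq_le sq.1/= -lerN2 opprD -!qN opprD; exact: sq.1.
move=> a x y; rewrite qD; congr (_ + _).
have [a0|/ltW a0] := leP 0 a; first exact: sublinearZ.
rewrite -[in LHS](opprK a) scaleNr qN sublinearZ ?oppr_ge0//.
by rewrite mulNr opprK.
Qed.

End sublinear.

(** * Norming functionals and the embedding given by the dual ball *)

Lemma sublinear_norm (R : realType) (V : normedModType R) :
  sublinear (fun x : V => `|x|).
Proof. by split=> [|a x a0]; [exact: ler_normD|rewrite normrZ ger0_norm]. Qed.

(** Tilting the norm along [x] first forces [h (- x) <= - |x|] for every linear [h] below the
    result; no extension from the line through [x] is involved. *)
Lemma norming_functional (R : realType) (V : normedModType R) (x : V) :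
  exists2 h : {linear V -> R^o}, forall y, `|h y| <= `|y| & h x = `|x|.
Proof.
have [q [sq qn qx]] := sublinear_tilt x (sublinear_norm V).
have [h hq] := hahn_banach_sublinear sq.
have hn y : h y <= `|y| := le_trans (hq y) (qn y).
exists h => [y|]; first by rewrite ler_norml hn andbT lerNl -raddfN -normrN hn.
apply/eqP; rewrite eq_le hn/= -lerN2 -raddfN; exact: le_trans (hq _) qx.
Qed.

(** Serves for two families: the dual ball itself, and coordinates indexed by it. *)
Lemma ell_infty_linear (R : realType) (V : normedModType R) (T : Type)
    (F : T -> {linear V -> R^o}) :
  (forall t x, `|F t x| <= `|x|) ->
  exists h : {linear V -> ell_infty R T},
    (forall x t, h x t = F t x) /\ (forall x, `|h x| <= `|x|).
Proof.
move=> Fn.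
have Fb x : (fun t => F t x) \in @bounded_pred R T.
  by apply/bounded_predP; exists `|x| => t; exact: Fn.
have [|h hE] := @linear_exists R V (ell_infty R T) (fun x => EllInfty (Fb x)).
  move=> a x y; apply/val_inj/funext => t /=; exact: linearP.
exists h; split=> [x t|x]; rewrite hE//.
by apply: sup_norm_le => // t; exact: Fn.
Qed.

Definition dual_ball (R : realType) (V : normedModType R) : Type :=
  {phi : {linear V -> R^o} | forall x, `|phi x| <= `|x|}.

Lemma dual_ball_embedding (R : realType) (V : normedModType R) :
  exists2 j : {linear V -> ell_infty R (dual_ball V)},
    forall x, `|j x| = `|x| & forall x phi, j x phi = sval phi x.
Proof.
have [j [jE jn]] := @ell_infty_linear R V (dual_ball V) _ (@svalP _ _).
exists j => // x; apply/eqP; rewrite eq_le jn/=.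
have [phi phin phix] := norming_functional x.
rewrite -{1}[`|x|]ger0_norm// -phix.
rewrite -(jE x (exist _ phi phin)); exact: sup_norm_ub.
Qed.

(* On the zero space only the zero functional is available, but it makes
   [ell_infty R (dual_ball Z)] nonzero, and so excludes [lambda < 0]. *)
Lemma injective_banach_ge0 (R : realType) (lambda : R)
  (Z : completeNormedModType R) : injective_banach lambda Z -> 0 <= lambda.
Proof.
move=> inj; have [j jn _] := dual_ball_embedding Z.
have [P [_ _ Pn]] := inj _ j jn.
have b1 : (fun _ : dual_ball Z => 1 : R) \in @bounded_pred R (dual_ball Z).
  by apply/bounded_predP; exists 1 => _; rewrite normr1.
pose one := EllInfty b1.
have [phi phin _] := norming_functional (0 : Z).
have one_gt0 : 0 < `|one|.
  apply: lt_le_trans ltr01 _; rewrite -[leLHS]normr1.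
  exact: (sup_norm_ub one (exist _ phi phin)).
by rewrite -(pmulr_lge0 _ one_gt0); exact: le_trans (Pn one).
Qed.

(** * Coordinates, the canonical embedding and affine extensions *)

Section coordinate_functionals.
Context (R : realType) (T : Type) (t : T).

Definition coord (e : ell_infty R T) : R^o := e t.

Lemma linear_coord : linear coord.
Proof. by []. Qed.

HB.instance Definition _ :=
  GRing.isLinear.Build R (ell_infty R T) R^o *:%R coord linear_coord.

Lemma coord_le (e : ell_infty R T) : `|coord e| <= `|e|.
Proof. exact: sup_norm_ub. Qed.

End coordinate_functionals.

Lemma isometry_canonical_embedding (R : realType) (X : metricType R) (t0 x y : X) :
  `|canonical_embedding t0 x - canonical_embedding t0 y| = mdist x y.
Proof.
set U := canonical_embedding t0.
apply/eqP; rewrite eq_le; apply/andP; split.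
  apply: sup_norm_le => [|f]; first exact: mdist_ge0.
  by have /set_mem[lf _] := valP f; rewrite -[leRHS]mul1r; exact: lf.
(* The distance to [y], shifted to vanish at [t0], attains the norm. *)
have fL : (fun t => mdist t y - mdist t0 y) \in pointed_lipschitz t0.
  apply/mem_set; split; last by rewrite subrr.
  move=> s t; rewrite mul1r opprB addrA subrK ler_norml.
  rewrite lerNl opprB !lerBlDr metric_triangle [mdist s t]metric_sym.
  by rewrite metric_triangle.
have : `|mdist x y - mdist t0 y - (mdist y y - mdist t0 y)| <= `|U x - U y|.
  exact: (sup_norm_ub (U x - U y) (SigSub fL)).
rewrite opprB addrA subrK mdistxx subr0; apply: le_trans; exact: ler_norm.
Qed.

Lemma klipschitz_affine (R : realType) (V W : normedModType R) (k : R)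
    (h : {linear V -> W}) (c : W) :
  (forall x, `|h x| <= k * `|x|) -> k.-lipschitz (fun x => h x + c).
Proof. by move=> hk [x y] _ /=; rewrite opprD addrACA subrr addr0 -linearB. Qed.

Lemma centered_in_pointed_lipschitz (R : realType) (X : metricType R) (t0 : X)
    (Z : normedModType R) (phi : {linear Z -> R^o}) (g : X -> Z) :
  (forall z, `|phi z| <= `|z|) -> metric_lipschitz 1 g ->
  (fun t => phi (g t - g t0)) \in pointed_lipschitz t0.
Proof.
move=> phin lg; apply/mem_set; split; last by rewrite subrr raddf0.
move=> x y; rewrite -raddfB opprB addrA subrK.
exact: le_trans (phin _) (lg x y).
Qed.

Theorem theorem3p2 (R : realType) (X : metricType R) (t0 : X) :
  let E := ell_infty R (pointed_lipschitz t0) in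
  let U : X -> E := canonical_embedding t0 in
  [/\ (forall x y : X, `|U x - U y| = mdist x y),
      (forall g : X -> R, metric_lipschitz 1 g ->
         exists g' : E -> R,
           [/\ 1.-lipschitz g', affine g' & g = g' \o U]) &
      (forall (lambda : R) (Z : completeNormedModType R),
         injective_banach lambda Z ->
         forall g : X -> Z, metric_lipschitz 1 g ->
         exists g' : E -> Z,
           [/\ lambda.-lipschitz g', affine g' & g = g' \o U])].
Proof.
move=> E U; split; first exact: isometry_canonical_embedding.
  move=> g lg.
  (* With the identity of the reals as functional, [g - g t0] is itself an index of [E]. *)
  have gL := @centered_in_pointed_lipschitz _ _ t0 R^o idfun g (fun=> lexx _) lg.
  pose h : {linear E -> R^o} := coord (SigSub gL).
  exists (fun e => h e + g t0); split.
  - by apply: klipschitz_affine => e; rewrite mul1r; exact: coord_le.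
  - by exists h, (g t0).
  - by apply/funext => t; rewrite /= /coord/= subrK.
move=> lambda Z injZ g lg.
(* The sign is what allows [|T e| <= |e|] to be multiplied by [lambda] in the final estimate. *)
have lambda_ge0 := injective_banach_ge0 injZ.
have [j jn jE] := dual_ball_embedding Z.
have [P [rangeP PK Pn]] := injZ _ j jn.
have gL (phi : dual_ball Z) :=
  centered_in_pointed_lipschitz t0 (svalP phi) lg.
pose F phi : {linear E -> R^o} := coord (SigSub (gL phi)).
have [T [TE Tn]] := ell_infty_linear (F := F) (fun phi e => coord_le _ e).
have j_inj : injective j.
  move=> x y jxy; apply/eqP; rewrite -subr_eq0 -normr_eq0 -jn linearB/= jxy.
  by rewrite subrr normr0.
have TU t : T (U t) = j (g t - g t0).
  by apply/val_inj/funext => phi; rewrite /= TE jE.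
have Pj z : P (j z) = j z.
  have : range P (j z) by rewrite rangeP; exists z.
  by move=> [w _ <-]; exact: PK.
have jP e : exists z, j z = P (T e).
  have : range j (P (T e)) by rewrite -rangeP; exists (T e).
  by move=> [z _ <-]; exists z.
(* This is the inverse of [j] after [P] and [T]; as [j] is injective, the chosen preimages depend
   linearly on [e]. *)
pose f e := sval (cid (jP e)).
have jf e : j (f e) = P (T e) := svalP (cid (jP e)).
have [|h hE] := @linear_exists R E Z f.
  by move=> a x y; apply: j_inj; rewrite linearP !jf !linearP.
exists (fun e => h e + g t0); split.
- apply: klipschitz_affine => e; rewrite hE -jn jf.
  by apply: le_trans (Pn _) _; rewrite ler_wpM2l.
- by exists h, (g t0).
- apply/funext => t; rewrite /= hE; apply/eqP; rewrite -subr_eq; apply/eqP.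
  by apply: j_inj; rewrite jf TU Pj.
Qed.
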